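(* Let $s\ge 2$ and let $n_1,n_2,\ldots,n_s$ be integers with $2\leq n_s<\cdots<n_2<n_1$. Let $S=\{n_1,n_2,\ldots,n_s\}$, and let $\delta(S)$ denote the minimum number of vertices of a one-realization of $S$. Then $$\delta(S)=\begin{cases}2n_1-n_s, & \text{if } n_1>n_2+1,\\ 2n_1-n_s-1, & \text{if } n_1=n_2+1.\end{cases}$$
   Context: A mixed hypergraph on a finite set $X$ is a triple $\mathcal{H}=(X,\mathcal{C},\mathcal{D})$, where $\mathcal{C}$ and $\mathcal{D}$ are families of subsets of $X$, called the $\mathcal{C}$-edges and $\mathcal{D}$-edges, respectively. The elements of $X$ are the vertices. A proper $k$-coloring of $\mathcal{H}$ is a mapping from $X$ into a set of $k$ colors such that each $\mathcal{C}$-edge contains two (distinct) vertices with a common color and each $\mathcal{D}$-edge contains two vertices with distinct colors. A strict $k$-coloring is a proper $k$-coloring using all $k$ colors. The feasible set $\mathcal{F}(\mathcal{H})$ is the set of all $k$ such that $\mathcal{H}$ has a strict $k$-coloring. For each $k$, let $r_k$ be the number of partitions of $X$ into $k$ nonempty classes that are the color classes of some strict $k$-coloring of $\mathcal{H}$ (so colorings differing only by renaming colors are counted once). The chromatic spectrum of $\mathcal{H}$ is the vector $(r_1,r_2,\ldots,r_{\overline{\chi}})$, where $\overline{\chi}$ is the maximum number of colors in a strict coloring of $\mathcal{H}$. For a set $S$ of positive integers, $\mathcal{H}$ is a realization of $S$ if $\mathcal{F}(\mathcal{H})=S$. It is a one-realization of $S$ if it is a realization of $S$ and every entry of its chromatic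 spectrum is either $0$ or $1$ (equivalently, $r_k=1$ for $k\in S$ and $r_k=0$ otherwise). *)

(* Defs.v *)
From mathcomp Require Import all_boot.

Set Implicit Arguments.
Unset Strict Implicit.
Unset Printing Implicit Defensive.

Record mixed_hypergraph (X : finType) := MixedHypergraph {
  C_edges : {set {set X}};
  D_edges : {set {set X}}
}.

Section Coloring.

Variables (X : finType) (H : mixed_hypergraph X).

Definition proper_coloring (k : nat) (c : {ffun X -> 'I_k}) : bool :=
  [forall C in C_edges H,
     [exists x in C, [exists y in C, (x != y) && (c x == c y)]]] &&
  [forall D in D_edges H,
     [exists x in D, [exists y in D, c x != c y]]].

Definition strict_coloring (k : nat) (c : {ffun X -> 'I_k}) : bool :=
  proper_coloring c && [forall i : 'I_k, [exists x : X, c x == i]].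

Definition feasible (k : nat) : bool :=
  [exists c : {ffun X -> 'I_k}, strict_coloring c].

Definition color_classes (k : nat) (c : {ffun X -> 'I_k}) : {set {set X}} :=
  [set c @^-1: [set i] | i : 'I_k].

Definition num_strict_partitions (k : nat) : nat :=
  #|[set P : {set {set X}} | [&& partition P [set: X], #|P| == k &
      [exists c : {ffun X -> 'I_k},
         strict_coloring c && (P == color_classes c)]]]|.

(* A strict k-coloring is onto 'I_k, so bounding k by #|X| loses nothing; the
   value is 0 when H has no strict coloring at all. *)
Definition upper_chromatic_number : nat :=
  \max_(k < #|X|.+1 | feasible k) k.

Definition chromatic_spectrum : seq nat :=
  [seq num_strict_partitions k | k <- iota 1 upper_chromatic_number].

Definition realization (S : {pred nat}) : Prop :=
  forall k : nat, feasible k <-> k \in S.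

Definition one_realization (S : {pred nat}) : Prop :=
  realization S /\ {in chromatic_spectrum, forall r, r = 0 \/ r = 1}.

End Coloring.

(* delta(S) = m, as a relation: m is attained, and it is a lower bound. *)
Definition is_delta (S : {pred nat}) (m : nat) : Prop :=
  (exists (X : finType) (H : mixed_hypergraph X),
     #|X| = m /\ one_realization H S) /\
  (forall (X : finType) (H : mixed_hypergraph X),
     one_realization H S -> m <= #|X|).

(* Main.v *)
Require Import Defs.
From mathcomp Require Import all_boot.
From mathcomp Require Import zify.

(* Lower bound: an [n 1]-coloring with fewer vertices has more than [n s]
   singleton classes, so an [n s]-coloring gives two of these singletons the same
   color; merging them keeps the [n 1]-coloring proper, because the only new
   monochromatic pair is not a D-edge. Hence [n 1 - 1] is feasible, and one vertex
   less would give two such merged pairs, i.e. two partitions into [n 1 - 1]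
   classes.

   Upper bound: take vertices x_0, ..., x_{max - 1} and y_0, ..., y_{a - 1}, where
   x_i = y_i for i < min, and for each m in S the coloring
   f_m(x_i) = (i if i < m, else 0), f_m(y_i) = min(i, m - 1). Let the edges be all
   those compatible with every f_m. If a proper coloring c separates some x_m from
   y_m, then for the least such m the edges of size 2 and 3 force c = f_m and m in
   S; otherwise c = f_max. One can take a = max, or a = max - 1 when the latter
   lies in S: the missing y only allows x_{max - 1} to join x_0, which is
   f_{max - 1}. *)

Set Implicit Arguments.
Unset Strict Implicit.
Unset Printing Implicit Defensive.

(** * Color classes of surjective colorings *)

Section ColorClasses.

Variable X : finType.

(** [c] factors through [d], so [d] is injective on a system of representatives of the colors of
    [c]. *)
Lemma onto_card_le (k l : nat) (c : {ffun X -> 'I_k}) (d : X -> 'I_l) :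
  [forall i, [exists x, c x == i]] ->
  (forall x y, d x = d y -> c x = c y) -> k <= l.
Proof.
move=> /forallP c_onto dc.
have g_ex i : {x | c x == i} by apply: sigW; apply/existsP.
have := @leq_card _ _ (fun i => d (sval (g_ex i))).
rewrite !card_ord; apply => i j /dc.
by rewrite (eqP (svalP (g_ex i))) (eqP (svalP (g_ex j))).
Qed.

Lemma color_classes_sub (k l : nat) (c : {ffun X -> 'I_k})
    (d : {ffun X -> 'I_l}) :
  [forall i, [exists x, c x == i]] ->
  (forall x y, (c x == c y) = (d x == d y)) ->
  color_classes c \subset color_classes d.
Proof.
move=> /forallP c_onto cd; apply/subsetP => _ /imsetP[i _ ->].
have /existsP[x /eqP <-] := c_onto i.
apply/imsetP; exists (d x) => //.
by apply/setP => y; rewrite !inE cd.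
Qed.

Lemma color_classes_eq (k l : nat) (c : {ffun X -> 'I_k})
    (d : {ffun X -> 'I_l}) :
  [forall i, [exists x, c x == i]] -> [forall i, [exists x, d x == i]] ->
  (forall x y, (c x == c y) = (d x == d y)) ->
  color_classes c = color_classes d.
Proof.
by move=> c_onto d_onto cd; apply/eqP; rewrite eqEsubset !color_classes_sub.
Qed.

Lemma same_color_classes (k l : nat) (c : {ffun X -> 'I_k})
    (d : {ffun X -> 'I_l}) x y :
  color_classes c = color_classes d -> c x = c y -> d x = d y.
Proof.
move=> cd cxy.
have : c @^-1: [set c x] \in color_classes d by rewrite -cd imset_f.
case/imsetP => i _ /setP E.
have := E x; have := E y; rewrite !inE cxy eqxx.
by move=> /esym/eqP -> /esym/eqP ->.
Qed.

Lemma color_classes_partition (k : nat) (c : {ffun X -> 'I_k}) :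
  [forall i, [exists x, c x == i]] ->
  partition (color_classes c) [set: X] /\ #|color_classes c| = k.
Proof.
move=> /forallP c_onto; split.
  apply/and3P; split.
  - apply/eqP/setP => x; rewrite inE; apply/bigcupP.
    by exists (c @^-1: [set c x]); rewrite ?imset_f // !inE.
  - apply/trivIsetP => _ _ /imsetP[i _ ->] /imsetP[j _ ->] neq.
    apply/pred0P => x /=; rewrite !inE.
    by apply/negP => /andP[/eqP ci /eqP cj]; rewrite -ci -cj eqxx in neq.
  - apply/imsetP => -[i _ /setP E].
    have /existsP[x /eqP ci] := c_onto i.
    by have := E x; rewrite !inE ci eqxx.
rewrite card_imset ?card_ord // => i j /setP E.
have /existsP[x /eqP ci] := c_onto i.
by have := E x; rewrite !inE ci eqxx => /esym/eqP.
Qed.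

End ColorClasses.

(** * Merging two singleton classes *)

Lemma merge_colors (a : nat) (i j : 'I_a.+1) : i != j ->
  exists2 h : 'I_a.+1 -> 'I_a, (forall l, exists l', h l' = l) &
    forall l l', (h l == h l') =
      (l == l') || (l \in [:: i; j]) && (l' \in [:: i; j]).
Proof.
(* [lift j] enumerates the colors other than [j]; [h] inverts it and sends [j] where it sends
   [i]. *)
rewrite eq_sym => neq_ji; have [i' def_i _] := unlift_some neq_ji.
exists (fun l => odflt i' (unlift j l)) => [l | l l'].
  by exists (lift j l); rewrite liftK.
have lift_j k : (lift j k == j) = false by rewrite eq_sym (negPf (neq_lift _ _)).
rewrite !inE def_i.
case: (unliftP j l) => [k|] ->; case: (unliftP j l') => [k'|] -> /=;
  rewrite ?(inj_eq lift_inj) ?lift_j ?eqxx ?orbF ?orbT ?andbT //=.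
- by case: eqP => // neq; apply/esym/negP => /andP[/eqP Ek /eqP Ek']; rewrite Ek Ek' in neq.
- by rewrite [j == _]eq_sym lift_j eq_sym.
Qed.

(** Merging keeps equal colors equal, so only a D-edge could fail. One that became monochromatic
    would lie inside [{x, y}], hence be monochromatic under [d] too. *)
Lemma merge_strict_coloring (X : finType) (H : mixed_hypergraph X) (a b : nat)
    (c : {ffun X -> 'I_a.+1}) (d : {ffun X -> 'I_b}) (x y : X) :
  strict_coloring H c -> strict_coloring H d -> x != y -> d x = d y ->
  (forall z, c z = c x -> z = x) -> (forall z, c z = c y -> z = y) ->
  exists2 e : {ffun X -> 'I_a}, strict_coloring H e &
    forall u v, (e u == e v) =
      (c u == c v) || (u \in [:: x; y]) && (v \in [:: x; y]).
Proof.
move=> /andP[/andP[/forall_inP cC /forall_inP cD] /forallP c_onto].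
move=> /andP[/andP[_ /forall_inP dD] _] neq_xy dxy cx cy.
have neq_c : c x != c y by apply: contra neq_xy => /eqP /cy ->.
have [h h_onto hE] := merge_colors neq_c.
have c_xy u : (c u \in [:: c x; c y]) = (u \in [:: x; y]).
  rewrite !inE; congr (_ || _); apply/eqP/eqP; by [apply: cx | apply: cy | move=> ->].
have eE u v : ([ffun u => h (c u)] u == [ffun u => h (c u)] v) =
    (c u == c v) || (u \in [:: x; y]) && (v \in [:: x; y]).
  by rewrite !ffunE hE !c_xy.
exists [ffun u => h (c u)] => //.
apply/andP; split; [apply/andP; split; apply/forall_inP|].
- move=> C /cC/exists_inP[u uC /exists_inP[v vC /andP[neq cuv]]].
  apply/exists_inP; exists u => //; apply/exists_inP; exists v => //.
  by rewrite neq eE cuv.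
- move=> D DH; have /exists_inP[u uD /exists_inP[v vD cuv]] := cD D DH.
  have /exists_inP[u' u'D /exists_inP[v' v'D duv]] := dD D DH.
  apply/exists_inP; exists u => //; apply/exists_inP.
  case: (boolP [exists w in D, [ffun u => h (c u)] u != [ffun u => h (c u)] w]).
    by move/exists_inP.
  rewrite negb_exists_in => /forall_inP e_const.
  have u_xy : u \in [:: x; y].
    by move: (e_const v vD); rewrite negbK eE (negPf cuv) => /andP[].
  have D_xy w : w \in D -> d w = d x.
    move=> /e_const; rewrite negbK eE => cuw.
    have: w \in [:: x; y].
      case/orP: cuw => [/eqP cuw|/andP[] //].
      by rewrite -c_xy -cuw c_xy.
    by rewrite !inE => /orP[] /eqP ->.
  by rewrite !D_xy // eqxx in duv.
- apply/forallP => l; have [l' <-] := h_onto l.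
  have /existsP[u /eqP <-] := c_onto l'.
  by apply/existsP; exists u; rewrite ffunE.
Qed.

(** * Spectrum entries and uniqueness of partitions *)

Lemma strict_coloring_leq (X : finType) (H : mixed_hypergraph X) k
    (c : {ffun X -> 'I_k}) : strict_coloring H c -> k <= #|X|.
Proof.
move=> /andP[_ c_onto].
by apply: (@onto_card_le _ _ _ c (fun x => enum_rank x)) => // x y /enum_rank_inj ->.
Qed.

Lemma feasible_spectrum (X : finType) (H : mixed_hypergraph X) k :
  0 < k -> feasible H k -> num_strict_partitions H k \in chromatic_spectrum H.
Proof.
move=> k_gt0 fk; apply: map_f; rewrite mem_iota k_gt0 add1n ltnS /=.
have /existsP[c /strict_coloring_leq k_le] := fk.
exact: (@leq_bigmax_cond _ (fun i : 'I_#|X|.+1 => feasible H i) (fun i => i : nat)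
  (Ordinal (n := #|X|.+1) k_le) fk).
Qed.

Lemma one_realization_color_classes (X : finType) (H : mixed_hypergraph X)
    (S : {pred nat}) k (c d : {ffun X -> 'I_k}) :
  one_realization H S -> 0 < k -> strict_coloring H c -> strict_coloring H d ->
  color_classes c = color_classes d.
Proof.
move=> [_ spec] k_gt0 cs ds.
have fk : feasible H k by apply/existsP; exists c.
have : num_strict_partitions H k <= 1 by case: (spec _ (feasible_spectrum k_gt0 fk)) => ->.
have in_set (e : {ffun X -> 'I_k}) : strict_coloring H e ->
    [&& partition (color_classes e) [set: X], #|color_classes e| == k &
      [exists c : {ffun X -> 'I_k},
         strict_coloring H c && (color_classes e == color_classes c)]].
  move=> es; have /andP[_ /color_classes_partition[-> ->]] := es.
  by rewrite eqxx; apply/existsP; exists e; rewrite es eqxx.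
by move/card_le1_eqP; apply; rewrite inE in_set.
Qed.

(** * Singleton classes and the two lower bounds *)

Definition singleton_classes (X : finType) k (c : {ffun X -> 'I_k}) : {set X} :=
  [set x | [forall z, (c z == c x) ==> (z == x)]].

Lemma singleton_classesP (X : finType) k (c : {ffun X -> 'I_k}) x :
  reflect (forall z, c z = c x -> z = x) (x \in singleton_classes c).
Proof.
rewrite inE; apply: (iffP forallP) => E z.
  by move=> /eqP; have /implyP/[apply]/eqP := E z.
by apply/implyP => /eqP /E ->.
Qed.

(** Each color contributes at least 2 to [#|X| + #|singleton_classes c|]: its class has two
    vertices, or a single one that is counted in both terms. *)
Lemma card_singleton_classes (X : finType) k (c : {ffun X -> 'I_k}) :
  [forall i, [exists x, c x == i]] -> 2 * k - #|singleton_classes c| <= #|X|.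
Proof.
move=> /forallP c_onto; rewrite leq_subLR addnC.
rewrite -!sum1_card (partition_big c xpredT) // [X in _ + X](partition_big c xpredT) //.
rewrite -big_split /=.
rewrite mulnC -[k in k * _]card_ord -sum_nat_const; apply: leq_sum => i _.
have /existsP[x /eqP ci] := c_onto i.
case: (boolP (x \in singleton_classes c)) => [xs|].
  by rewrite (bigD1 x) ?ci // [X in _ + X](bigD1 x) ?xs ?ci //=; lia.
rewrite inE negb_forall => /existsP[z]; rewrite negb_imply => /andP[/eqP cz neq].
by rewrite (bigD1 x) ?ci //= (bigD1 z) ?neq ?cz ?ci ?eqxx.
Qed.

Lemma pigeonhole (X : finType) (b : nat) (d : X -> 'I_b) (A : {set X}) :
  b < #|A| -> exists x y, [/\ x \in A, y \in A, x != y & d x = d y].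
Proof.
move=> b_lt; case: (boolP (dinjectiveb d A)) => [/dinjectiveP d_inj|].
  have := max_card (mem (d @: A)).
  by rewrite card_in_imset // card_ord leqNgt b_lt.
by case/dinjectivePn => x xA [y /andP[neq yA] dxy]; exists x, y; rewrite eq_sym.
Qed.

Lemma one_realization_card_gap (X : finType) (H : mixed_hypergraph X)
    (S : {pred nat}) a b :
  one_realization H S -> 0 < a -> a \in S -> b \in S -> a.-1 \notin S ->
  2 * a - b <= #|X|.
Proof.
case: a => // a [real _] _ /real/existsP[c cs] /real/existsP[d ds] /= aS.
have /andP[_ /card_singleton_classes card_c] := cs.
rewrite leqNgt; apply/negP => /(leq_ltn_trans card_c) lt_b.
have : b < #|singleton_classes c| by lia.
case/(pigeonhole d) => x [y] [/singleton_classesP cx /singleton_classesP cy neq dxy].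
have [e es _] := merge_strict_coloring cs ds neq dxy cx cy.
by case/negP: aS; apply/real/existsP; exists e.
Qed.

Lemma one_realization_card (X : finType) (H : mixed_hypergraph X)
    (S : {pred nat}) a b :
  one_realization H S -> 1 < a -> a \in S -> b \in S -> 2 * a - b - 1 <= #|X|.
Proof.
case: a => // a HS; have [real _] := HS.
move=> a_gt0 /real/existsP[c cs] /real/existsP[d ds].
have /andP[_ /card_singleton_classes card_c] := cs.
rewrite leqNgt; apply/negP => /(leq_ltn_trans card_c) lt_b.
have b_lt : b < #|singleton_classes c| by lia.
have [x [y [xs ys neq dxy]]] := pigeonhole d b_lt.
(* By [lt_b] more than [b] singletons remain without [x], so a second pair can be chosen that avoids
   [x]. *)
have : b < #|singleton_classes c :\ x| by rewrite (cardsD1 x) xs in lt_b *; lia.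
case/(pigeonhole d) => x' [y'] [/setD1P[x'x x's] /setD1P[y'x y's] neq' dxy'].
have [e es eE] := merge_strict_coloring cs ds neq dxy
  (singleton_classesP _ _ xs) (singleton_classesP _ _ ys).
have [e' es' eE'] := merge_strict_coloring cs ds neq' dxy'
  (singleton_classesP _ _ x's) (singleton_classesP _ _ y's).
have /same_color_classes ee' := one_realization_color_classes HS a_gt0 es es'.
(* By uniqueness [e'] also identifies [x] and [y]; as [x] is outside the pair merged by [e'],
   already [c x = c y]. *)
have /eqP/ee'/eqP : e x == e y by rewrite eE !inE !eqxx orbT /= orbT.
rewrite eE' !inE ![x == _]eq_sym (negPf x'x) (negPf y'x) /= orbF => /eqP cxy.
by move: neq; rewrite (singleton_classesP _ _ ys _ cxy) eqxx.
Qed.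

(** * The hypergraph of a family of colorings *)

Section FamilyHypergraph.

Variables (X : finType) (S : seq nat) (f : nat -> X -> nat).

(* The mixed hypergraph with the most edges for which every [f m], [m \in S],
   is a proper coloring. *)
Definition family_hypergraph : mixed_hypergraph X := MixedHypergraph
  [set C : {set X} | all (fun m =>
     [exists x in C, [exists y in C, (x != y) && (f m x == f m y)]]) S]
  [set D : {set X} | all (fun m =>
     [exists x in D, [exists y in D, f m x != f m y]]) S].

(** Here [{u, v}] is a D-edge. This and [family_triple] are all that the rigidity argument uses
    about edges. *)
Lemma family_pair k (c : {ffun X -> 'I_k}) u v :
  proper_coloring family_hypergraph c ->
  (forall m, m \in S -> f m u != f m v) -> c u != c v.
Proof.
move=> /andP[_ /forall_inP cD] fuv.
have /cD : [set u; v] \in D_edges family_hypergraph.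
  rewrite inE; apply/allP => m mS.
  apply/exists_inP; exists u; rewrite ?set21 //.
  by apply/exists_inP; exists v; rewrite ?set22 ?fuv.
case/exists_inP => x /set2P xuv /exists_inP[y /set2P yuv].
by case: xuv yuv => -> [] ->; rewrite ?eqxx // eq_sym.
Qed.

Lemma family_triple k (c : {ffun X -> 'I_k}) u v w :
  proper_coloring family_hypergraph c ->
  (forall m, m \in S -> [|| f m u == f m v, f m v == f m w | f m u == f m w]) ->
  [|| c u == c v, c v == c w | c u == c w].
Proof.
move=> /andP[/forall_inP cC _] fuvw.
have [->|uv] := eqVneq u v; first by rewrite eqxx.
have [->|vw] := eqVneq v w; first by rewrite eqxx orbT.
have [->|uw] := eqVneq u w; first by rewrite eqxx !orbT.
have /cC : [set u; v; w] \in C_edges family_hypergraph.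
  rewrite inE; apply/allP => m /fuvw E.
  have [uT vT wT] : [/\ u \in [set u; v; w], v \in [set u; v; w] & w \in [set u; v; w]].
    by rewrite !inE !eqxx !orbT.
  case/or3P: E => E.
  - by apply/exists_inP; exists u => //; apply/exists_inP; exists v; rewrite ?uv.
  - by apply/exists_inP; exists v => //; apply/exists_inP; exists w; rewrite ?vw.
  - by apply/exists_inP; exists u => //; apply/exists_inP; exists w; rewrite ?uw.
case/exists_inP => x xT /exists_inP[y yT /andP[]].
move: xT yT; rewrite !inE.
by do 2![case/orP => [/orP[]|] /eqP ->]; rewrite ?eqxx // => _;
  rewrite 1?[_ == c u]eq_sym ?[c w == c v]eq_sym => ->; rewrite ?orbT.
Qed.

Hypothesis f_lt : forall m x, m \in S -> f m x < m.
Hypothesis f_onto : forall m i, m \in S -> i < m -> exists x, f m x = i.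
(** As [c] need not be onto, [k] may exceed [m]; [strict_family] recovers [k = m] for strict
    colorings. *)
Hypothesis f_only : forall k (c : {ffun X -> 'I_k}),
  proper_coloring family_hypergraph c ->
  exists2 m, m \in S & forall u v, (c u == c v) = (f m u == f m v).

Lemma family_strict m : m \in S ->
  exists2 c : {ffun X -> 'I_m}, strict_coloring family_hypergraph c &
    forall u v, (c u == c v) = (f m u == f m v).
Proof.
move=> mS; pose c := [ffun x => Ordinal (f_lt x mS)].
have cE u v : (c u == c v) = (f m u == f m v) by rewrite !ffunE.
exists c => //; apply/andP; split; [apply/andP; split; apply/forall_inP|].
- move=> C; rewrite inE => /allP/(_ m mS)/exists_inP[u uC /exists_inP[v vC fuv]].
  by apply/exists_inP; exists u => //; apply/exists_inP; exists v; rewrite ?cE.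
- move=> D; rewrite inE => /allP/(_ m mS)/exists_inP[u uD /exists_inP[v vD fuv]].
  by apply/exists_inP; exists u => //; apply/exists_inP; exists v; rewrite ?cE.
- apply/forallP => i; have [x fx] := f_onto mS (ltn_ord i).
  by apply/existsP; exists x; rewrite ffunE -val_eqE /= fx.
Qed.

Lemma strict_family k (c : {ffun X -> 'I_k}) :
  strict_coloring family_hypergraph c ->
  k \in S /\ forall u v, (c u == c v) = (f k u == f k v).
Proof.
move=> /andP[/f_only[m mS cE] c_onto].
have [d /andP[_ d_onto] dE] := family_strict mS.
(* [c] and [d] are onto and induce the same partition, so they have equally many colors. *)
suff km : m = k by split=> [|u v]; rewrite ?cE -km.
apply/esym/eqP; rewrite eqn_leq; apply/andP; split.
- by apply: (onto_card_le (d := d) c_onto) => u v /eqP; rewrite dE -cE => /eqP.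
- by apply: (onto_card_le (d := c) d_onto) => u v /eqP; rewrite cE -dE => /eqP.
Qed.

Lemma family_one_realization : one_realization family_hypergraph (mem S).
Proof.
split=> [k|_ /mapP[k _ ->]].
  split=> [/existsP[c /strict_family[]] // | kS].
  by apply/existsP; have [c] := family_strict kS; exists c.
suff : num_strict_partitions family_hypergraph k <= 1 by case: num_strict_partitions => [|[]]; auto.
apply/card_le1_eqP => P Q; rewrite !inE.
move=> /and3P[_ _ /existsP[c /andP[cs /eqP ->]]].
move=> /and3P[_ _ /existsP[d /andP[ds /eqP ->]]].
have [[_ cE] [_ dE]] := (strict_family cs, strict_family ds).
case/andP: cs => _ c_onto; case/andP: ds => _ d_onto.
by apply: color_classes_eq => // u v; rewrite cE dE.
Qed.

End FamilyHypergraph.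

(** * Vertices and colorings of the construction *)

Section Construction.

Variables (p a b : nat) (S : seq nat).

(* The left summand holds the x_i, the right one the y_i with [b <= i < a]; here
   [p.+1] is the maximum of [S] and [b] its minimum. *)
Definition vertex : finType := ('I_p.+1 + 'I_(a - b))%type.

Definition vx (i : nat) : vertex := inl (inord i).

(* Meaningful for [i < a] only; the value [vx 0] is junk. *)
Definition vy (i : nat) : vertex :=
  if i < b then vx i else if insub (i - b) is Some j then inr j else vx 0.

(** This is [f_m]; [inr j] stands for [y_(b + j)]. On [x_i = y_i] with [i < b <= m], the formulas
    for x and y both give [i]. *)
Definition level_color (m : nat) (v : vertex) : nat :=
  match v with
  | inl i => if i < m then i : nat else 0
  | inr j => minn (b + j) m.-1
  end.

Hypothesis b_gt1 : 1 < b.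
Hypothesis S_bounds : forall m, m \in S -> b <= m <= p.+1.
Hypothesis top_in : p.+1 \in S.
Hypothesis a_cases : a = p.+1 \/ a = p /\ p \in S.

Lemma level_color_vx m i : i <= p -> level_color m (vx i) = if i < m then i else 0.
Proof. by move=> ip; rewrite /= inordK. Qed.

Lemma level_color_vy m i : m \in S -> i < a -> level_color m (vy i) = minn i m.-1.
Proof.
move=> /S_bounds bm ia; rewrite /vy; case: ifP => ib.
  by rewrite level_color_vx; [case: ifP; lia | lia].
case: insubP => [j _ /= ->|]; [|by rewrite ltn_sub2r; lia].
by congr minn; lia.
Qed.

Lemma vertexP v :
  (exists2 i, i <= p & v = vx i) \/ (exists2 i, b <= i < a & v = vy i).
Proof.
case: v => [i|j]; [left; exists i; rewrite -1?ltnS // /vx inord_val //|right].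
exists (b + j); first by have := ltn_ord j; lia.
rewrite /vy ifF ?addKn; last by lia.
by rewrite insubT ?ltn_ord // => ltj; congr inr; apply: val_inj.
Qed.

Lemma vy_small i : i < b -> vy i = vx i.
Proof. by rewrite /vy => ->. Qed.

Let H := family_hypergraph S level_color.

(** * Every proper coloring induces the partition of some [f_m] *)

Section Rigidity.

Variables (k : nat) (c : {ffun vertex -> 'I_k}).
Hypothesis c_proper : proper_coloring H c.

(** Under [f_m] the color of [y_j] is nonzero, as [m > 1], so it can equal that of [x_i] only if
    [i = m - 1 < j], which the last hypothesis excludes. *)
Lemma vx_vy_neq i j : i <= p -> j < a -> i != j -> j != 0 ->
  (i < j -> i.+1 \notin S) -> c (vx i) != c (vy j).
Proof.
move=> ip ja ij j0 iS; apply: (family_pair c_proper) => m mS.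
have bm := S_bounds mS.
rewrite level_color_vx // level_color_vy //.
have [|im] := boolP ((i < j) && (m == i.+1)); last by case: ifP; lia.
by case/andP => /iS + /eqP mE; rewrite -mE mS.
Qed.

(** The vertices [x_0, ..., x_(m - 1)] represent the classes of [f_m], so it suffices to compare [c]
    on them. *)
Lemma level_color_rigid m : m \in S ->
  (forall v, c v = c (vx (level_color m v))) ->
  (forall i j, i < j < m -> c (vx i) != c (vx j)) ->
  forall u v, (c u == c v) = (level_color m u == level_color m v).
Proof.
move=> mS cE c_inj u v; have bm := S_bounds mS.
have f_lt w : level_color m w < m.
  by case: w => /= j; [case: ifP; lia | lia].
apply/eqP/eqP => [|E]; last by rewrite cE E -cE.
rewrite cE [RHS]cE => E; have fu := f_lt u; have fv := f_lt v.
case: (ltngtP (level_color m u) (level_color m v)) => // lt.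
- by have := c_inj _ _ (introT andP (conj lt fv)); rewrite E eqxx.
- by have := c_inj _ _ (introT andP (conj lt fu)); rewrite E eqxx.
Qed.

(** Replacing [x_i] by its match [y_i] makes [vx_vy_neq] apply if [i != 0]. For [i = 0] it is [x_j]
    that is replaced, which fails only when [j = a], where [y_j] does not exist. *)
Lemma matched_prefix_neq m i j : i < j < m -> m <= p.+1 ->
  (forall l, l < minn m a -> c (vx l) = c (vy l)) ->
  i = 0 /\ j = a \/ c (vx i) != c (vx j).
Proof.
move=> ijm mp c_match.
have [->|i0] := eqVneq i 0.
  have [->|ja] := eqVneq j a; [by left | right].
  rewrite (c_match j); last by lia.
  apply: vx_vy_neq; try lia.
  by move=> _; apply/negP => /S_bounds; lia.
right; rewrite (c_match i) 1?eq_sym; last by lia.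
by apply: vx_vy_neq; lia.
Qed.

Lemma rigid_all_matched : (forall j, j < a -> c (vx j) = c (vy j)) ->
  exists2 m, m \in S &
    forall u v, (c u == c v) = (level_color m u == level_color m v).
Proof.
move=> c_match.
(* In the first case [c] is [f_p], otherwise [f_(p + 1)]. *)
have [/andP[/eqP aE /eqP c0]|] := boolP ((a == p) && (c (vx 0) == c (vx p))).
  exists p; first by case: a_cases => [|[]] //; lia.
  have pS : p \in S by case: a_cases => [|[]] //; lia.
  have bp := S_bounds pS.
  apply: level_color_rigid => // [v|i j ij].
    case: (vertexP v) => -[i ip ->].
      rewrite level_color_vx //; case: ifP => // ip'; rewrite c0; congr (c (vx _)); lia.
    rewrite level_color_vy //; last by lia.
    by rewrite -c_match; [congr (c (vx _)); lia | lia].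
  case: (@matched_prefix_neq p i j) => //; last by lia.
  by move=> l lp; apply: c_match; lia.
move=> c0; exists p.+1 => //.
apply: level_color_rigid => // [v|i j ij].
  case: (vertexP v) => -[i ip ->].
    by rewrite level_color_vx // ltnS ip.
  rewrite level_color_vy //; last by lia.
  rewrite -c_match; last by lia.
  by congr (c (vx _)); case: a_cases => [|[]]; lia.
case: (@matched_prefix_neq p.+1 i j) => //.
  by move=> l lp; apply: c_match; lia.
(* The exceptional pair is [x_0, x_p] with [a = p], already treated as the first case. *)
case=> i0 ja; move: c0; rewrite i0 ja.
have -> : a = p by lia.
by rewrite eqxx.
Qed.

Lemma rigid_first_unmatched m : m < a -> c (vx m) != c (vy m) ->
  (forall j, j < m -> c (vx j) = c (vy j)) ->
  exists2 m, m \in S &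
    forall u v, (c u == c v) = (level_color m u == level_color m v).
Proof.
move=> ma c_m c_match.
have ap : a <= p.+1 by case: a_cases => [|[]]; lia.
have bm : b <= m.
  by rewrite leqNgt; apply: contra c_m => /vy_small ->.
have y0 j : 0 < j < a -> c (vy j) != c (vx 0).
  move=> ja; rewrite eq_sym; apply: vx_vy_neq; try lia.
  by move=> _; apply/negP => /S_bounds; lia.
(* [f_t] identifies [x_m] with [y_m] if [t > m], and [x_m] with [x_0] if [t <= m]. All triples below
   contain [x_m] and [y_m], so only [t <= m] matters for them. *)
have xm : c (vx m) = c (vx 0).
  have : [|| c (vx m) == c (vy m), c (vy m) == c (vx 0) | c (vx m) == c (vx 0)].
    apply: (family_triple c_proper) => t tS; have bt := S_bounds tS.
    rewrite !level_color_vx ?level_color_vy; try lia.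
    by do ?case: ifP; lia.
  by rewrite (negPf c_m) (negPf (y0 _ _)) /=; [move/eqP | lia].
(* [f_m] gives [y_m] and [x_(m - 1)] the color [m - 1]; for [t < m], [f_t] gives [x_m] and
   [x_(m - 1)] the color 0. *)
have ym : c (vy m) = c (vx m.-1).
  have : [|| c (vx m) == c (vy m), c (vy m) == c (vx m.-1) | c (vx m) == c (vx m.-1)].
    apply: (family_triple c_proper) => t tS; have bt := S_bounds tS.
    rewrite !level_color_vx ?level_color_vy; try lia.
    by do ?case: ifP; lia.
  have /negPf x0 : c (vx 0) != c (vx m.-1).
    by rewrite eq_sym c_match; [apply: y0 | ]; lia.
  by rewrite (negPf c_m) xm x0 orbF => /eqP.
(* Among all [f_t], only [f_m] identifies [x_(m - 1)] with [y_m]. *)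
have mS : m \in S.
  apply: contraT => mS.
  have : c (vx m.-1) != c (vy m).
    by apply: vx_vy_neq; try lia; move=> _; rewrite prednK //; lia.
  by rewrite ym eqxx.
(* For [t <= m], [f_t] gives [x_j] the color of [x_m]; in [yk] below it likewise gives [y_j] the
   color of [y_m]. *)
have xk j : m <= j <= p -> c (vx j) = c (vx 0).
  move=> mj; have [-> //|jm] := eqVneq j m.
  have : [|| c (vx m) == c (vy m), c (vy m) == c (vx j) | c (vx m) == c (vx j)].
    apply: (family_triple c_proper) => t tS; have bt := S_bounds tS.
    rewrite !level_color_vx ?level_color_vy; try lia.
    by do ?case: ifP; lia.
  rewrite (negPf c_m) /= xm eq_sym (negPf (@vx_vy_neq j m _ _ _ _ _)); try lia.
  by move/eqP.
have yk j : m <= j < a -> c (vy j) = c (vx m.-1).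
  move=> mj; rewrite -ym.
  have : [|| c (vx m) == c (vy m), c (vy m) == c (vy j) | c (vx m) == c (vy j)].
    apply: (family_triple c_proper) => t tS; have bt := S_bounds tS.
    rewrite !level_color_vx ?level_color_vy; try lia.
    by do ?case: ifP; lia.
  rewrite (negPf c_m) /= xm [c (vx 0) == _]eq_sym (negPf (y0 _ _)) ?orbF; last by lia.
  by move/eqP.
exists m => //; apply: level_color_rigid => // [v|i j ij].
  case: (vertexP v) => -[i ip ->].
    by rewrite level_color_vx //; case: ifP => // im; apply: xk; lia.
  rewrite level_color_vy //; last by lia.
  have [im|im] := ltnP i m.
    by rewrite -c_match //; congr (c (vx _)); lia.
  by rewrite yk; [congr (c (vx _)); lia | lia].
case: (@matched_prefix_neq m i j) => //; [lia | | lia].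
by move=> l lm; apply: c_match; lia.
Qed.

Lemma rigid : exists2 m, m \in S &
  forall u v, (c u == c v) = (level_color m u == level_color m v).
Proof.
have [/forallP c_match|] := boolP [forall j : 'I_a, c (vx j) == c (vy j)].
  by apply: rigid_all_matched => j ja; apply/eqP/(c_match (Ordinal ja)).
rewrite negb_forall => /existsP[j0 j0P].
have ex : exists j, (j < a) && (c (vx j) != c (vy j)) by exists j0; rewrite ltn_ord.
case: (ex_minnP ex) => m /andP[ma c_m] m_min.
apply: (rigid_first_unmatched ma c_m) => j jm; apply/eqP; apply: contraT => cj.
by have := m_min j; rewrite cj (ltn_trans jm ma) leqNgt jm => /(_ isT).
Qed.

End Rigidity.

Lemma construction_one_realization : one_realization H (mem S).
Proof.
apply: family_one_realization => [m v mS | m i mS im | k c]; last exact: rigid.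
- have bm := S_bounds mS.
  by case: v => /= j; [case: ifP; lia | lia].
- have bm := S_bounds mS.
  by exists (vx i); rewrite level_color_vx ?im //; lia.
Qed.

Lemma card_vertex : #|vertex| = p.+1 + (a - b).
Proof. by rewrite card_sum !card_ord. Qed.

End Construction.

Theorem theorem1p1 (s : nat) (n : nat -> nat) (hs : 2 <= s)
  (hn_min : 2 <= n s)
  (hn_decr : forall i : nat, 1 <= i -> i < s -> n i.+1 < n i) :
  let S := [seq n i | i <- iota 1 s] in
  (n 1 > n 2 + 1 -> is_delta (mem S) (2 * n 1 - n s)) /\
  (n 1 = n 2 + 1 -> is_delta (mem S) (2 * n 1 - n s - 1)).
Proof.
move=> S.
have n_anti i j : 1 <= i -> i <= j -> j <= s -> n j <= n i.
  move=> i1; elim: j => [|j IH] ij js; first by lia.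
  have [-> //|ij'] := eqVneq i j.+1.
  have ij1 : i <= j by lia.
  have j1 : 1 <= j by lia.
  exact: leq_trans (ltnW (hn_decr _ j1 js)) (IH ij1 (ltnW js)).
have nS i : 1 <= i <= s -> n i \in S.
  by move=> i1s; apply: map_f; rewrite mem_iota; lia.
have S_bounds m : m \in S -> n s <= m <= n 1.
  by case/mapP => i; rewrite mem_iota => i1s ->; apply/andP; split; apply: n_anti; lia.
have n21 : n s <= n 2 < n 1 by rewrite n_anti ?hn_decr.
have [n1S n2S nsS] : [/\ n 1 \in S, n 2 \in S & n s \in S] by split; apply: nS; lia.
case n1E: (n 1) => [|p]; first by lia.
rewrite n1E in n1S n21 S_bounds; split=> gap; split.
(* With [a = n 1] there are [n 1 + (n 1 - n s)] vertices. *)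
- exists (vertex p p.+1 (n s)), (family_hypergraph S (@level_color p p.+1 (n s))).
  split; first by rewrite card_vertex; lia.
  by apply: construction_one_realization; auto.
(* The gap puts [p = n 1 - 1] strictly between [n 2] and [n 1], hence outside [S]. *)
- move=> X H HS; apply: (one_realization_card_gap HS) => //=.
  apply/negP => /mapP[i]; rewrite mem_iota => i1s pE.
  have [i1|i1] := eqVneq i 1; first by rewrite i1 in pE; lia.
  by have := n_anti 2 i; lia.
- have pE : n 2 = p by lia.
  rewrite pE in n2S n21.
  (* Since [p = n 2] lies in [S], the choice [a = p] is allowed and saves one vertex. *)
  exists (vertex p p (n s)), (family_hypergraph S (@level_color p p (n s))).
  split; first by rewrite card_vertex; lia.
  by apply: construction_one_realization; auto.
- by move=> X H HS; apply: (one_realization_card HS) => //; lia.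
Qed.
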